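(* Let $V\in\mathcal V$ be a Volterra operator with associated skew-symmetric matrix $(a_{ki})_{k,i\in\mathbb N}$. Then $V$ is an extreme point of $\mathcal V$ if and only if $|a_{ki}|=1$ for all $k,i\in\mathbb N$ with $k\neq i$.
   Context: $S=\{x=(x_n)_{n\in\mathbb N}\in\ell^1 : x_n\ge 0,\ \sum_{n=1}^\infty x_n=1\}$. $\mathcal V$ denotes the set of Volterra operators, i.e. maps $V:S\to S$ of the form $(V(x))_k=x_k\bigl(1+\sum_{i=1}^\infty a_{ki}x_i\bigr)$, $k\in\mathbb N$, where $(a_{ki})$ is a real matrix with $a_{ki}=-a_{ik}$ and $|a_{ki}|\le1$ for all $k,i\in\mathbb N$; the matrix $(a_{ki})$ is uniquely determined by $V$ and is called the associated skew-symmetric matrix. (Equivalently, $V(x)=\tilde V(x,x)$ with $(\tilde V(x,y))_k=\sum_{i,j}p_{ij,k}x_iy_j$, $p_{ij,k}=p_{ji,k}\ge0$, $\sum_kp_{ij,k}=1$, and $p_{ij,k}=0$ whenever $k\notin\{i,j\}$.) Convex combinations of operators are taken pointwise. *)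

(* Defs.v *)
From HB Require Import structures.
From mathcomp Require Import all_boot all_order all_algebra.
From mathcomp Require Import all_classical all_reals all_analysis.

Set Implicit Arguments.
Unset Strict Implicit.
Unset Printing Implicit Defensive.

Import Order.TTheory GRing.Theory Num.Theory.
Import numFieldNormedType.Exports.

Local Open Scope classical_set_scope.
Local Open Scope ring_scope.

Definition extreme_point (R : numDomainType) (E : lmodType R) (C : set E)
    (v : E) : Prop :=
  C v /\
  forall (x y : E) (t : R), C x -> C y -> 0 < t < 1 ->
    v = t *: x + (1 - t) *: y -> x = v /\ y = v.

(* Sequences are indexed from 0. The codomain is [R^o] so that sequences, and
   maps into sequences, carry the pointwise [lmodType R] structure. *)
Definition simplex (R : realType) : set (nat -> R^o) :=
  [set x : nat -> R^o | [/\ cvgn (series (fun n => `|x n|) : R^nat),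
                          (forall n, 0 <= x n) &
                          limn (series x : R^nat) = 1]].
Arguments simplex : clear implicits.

Definition skew_matrix (R : realType) (a : nat -> nat -> R) : Prop :=
  forall k i, a k i = - a i k /\ `|a k i| <= 1.

(* The series below converges absolutely when [skew_matrix a], so [limn] is
   a genuine limit. *)
Definition volterra_with (R : realType) (a : nat -> nat -> R)
    (V : simplex R -> simplex R) : Prop :=
  skew_matrix a /\
  forall (x : simplex R) (k : nat),
    val (V x) k =
      val x k * (1 + limn (series (fun i => a k i * val x i) : R^nat)).

Definition volterra (R : realType) : set (simplex R -> simplex R) :=
  [set V | exists a : nat -> nat -> R, volterra_with a V].
Arguments volterra : clear implicits.

(* An operator of the simplex seen in the vector space of all maps from the
   simplex to sequences, where convex combinations are taken pointwise. *)
Definition to_seq_map (R : realType) (V : simplex R -> simplex R) :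
    simplex R -> (nat -> R^o) :=
  fun x => val (V x).

(* Main.v *)
(* The value of a Volterra operator at the midpoint of the vertices [k] and [i]
   reveals the entry [a k i], so a convex decomposition of operators is an
   entrywise convex decomposition of matrices; [1] and [-1] are extreme in
   [[-1, 1]]. Conversely, if [`|a k i| < 1], shifting [a k i] by [s] and [a i k]
   by [- s], with [s = 1 - `|a k i|] or its opposite, yields two distinct
   Volterra operators whose average is [V]. *)
Require Import Defs.
From HB Require Import structures.
From mathcomp Require Import all_boot all_order all_algebra.
From mathcomp Require Import all_classical all_reals all_analysis.
From mathcomp Require Import ring lra.
Import Order.TTheory GRing.Theory Num.Theory.
Import numFieldNormedType.Exports.
Local Open Scope classical_set_scope.
Local Open Scope ring_scope.

(** The partial sums are constant, equal to [c m], as soon as [m < n]. *)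
Lemma cvg_series_delta {R : realType} (c : R ^nat) (m : nat) :
  series (fun n => c n * (n == m)%:R) @ \oo --> c m.
Proof.
apply: cvg_near_cst; near=> n.
have mn : (m < n)%N by near: n; exact: nbhs_infty_gt.
rewrite /series /= (bigD1_seq m) ?iota_uniq //=; last by rewrite mem_index_iota.
by rewrite eqxx mulr1 big1 ?addr0// => j /negbTE ->; rewrite mulr0.
Unshelve. all: by end_near. Qed.

(** For nonnegative terms absolute convergence is convergence; total mass one becomes a limit
    statement that can be added to others. *)
Lemma simplexP {R : realType} (x : nat -> R^o) :
  simplex R x <->
  (forall n, 0 <= x n) /\ series (x : R ^nat) @ \oo --> (1 : R).
Proof.
split=> [[xcv x0 x1]|[x0 x1]].
  by split=> //; rewrite -x1; exact: (@normed_cvg _ R^o).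
split => //; last exact: cvg_lim.
suff -> : (fun n => `|x n|) = x by apply/cvg_ex; exists 1.
by apply/funext => n; rewrite ger0_norm.
Qed.

Lemma skew_matrix_diag {R : realType} {a : nat -> nat -> R} (k : nat) :
  skew_matrix a -> a k k = 0.
Proof. by move=> /(_ k k)[akk _]; lra. Qed.

Section row.
Context {R : realType} {a : nat -> nat -> R} (ska : skew_matrix a).
Context {x : nat -> R^o} (Sx : simplex R x).

Lemma le_norm_row k i : `|a k i * x i| <= x i.
Proof.
have [x0 _] := (simplexP x).1 Sx.
by rewrite normrM (ger0_norm (x0 i)) ler_piMl// (ska k i).2.
Qed.

Lemma is_cvg_norm_row k : cvgn [normed series (fun i => a k i * x i : R)].
Proof.
have [x0 x1] := (simplexP x).1 Sx.
apply: (@series_le_cvg _ _ x) => // [n|n|]; [exact: normr_ge0|exact: le_norm_row|].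
by apply/cvg_ex; exists 1.
Qed.

Lemma is_cvg_row k : cvgn (series (fun i => a k i * x i : R)).
Proof. exact: (@normed_cvg _ R^o _ (is_cvg_norm_row k)). Qed.

(** The row series is dominated termwise by [x], which has mass 1. This keeps the factor of [x k] in
    a Volterra operator nonnegative. *)
Lemma norm_lim_row_le1 k : `|limn (series (fun i => a k i * x i : R))| <= 1.
Proof.
have [x0 x1] := (simplexP x).1 Sx.
apply: le_trans (@lim_series_norm _ R^o _ (is_cvg_norm_row k)) _.
rewrite -[leRHS](cvg_lim _ x1)//.
apply: (@lim_series_le R) => //; first exact: is_cvg_norm_row.
- by apply/cvg_ex; exists 1.
- exact: le_norm_row.
Qed.

End row.

Definition midpoint {R : realType} (k i : nat) : nat -> R^o :=
  fun n => 2^-1 * (n == k)%:R + 2^-1 * (n == i)%:R.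

Lemma cvg_series_midpoint {R : realType} (c : R ^nat) (k i : nat) :
  series (fun n => c n * midpoint k i n) @ \oo --> (c k + c i) / 2.
Proof.
have -> : (fun n => c n * midpoint k i n) =
    (fun n => c n / 2 * (n == k)%:R) + (fun n => c n / 2 * (n == i)%:R).
  by apply/funext => n; rewrite /midpoint /= !fctE; lra.
rewrite seriesD mulrDl.
by apply: cvgD; exact: (cvg_series_delta (fun n => c n / 2)).
Qed.

Lemma simplex_midpoint {R : realType} (k i : nat) :
  simplex R (midpoint k i).
Proof.
apply/simplexP; split=> [n|].
  by rewrite addr_ge0// mulr_ge0// invr_ge0.
have := cvg_series_midpoint (fun=> 1 : R) k i.
have -> : (1 + 1) / 2 = 1 :> R by lra.
by under eq_fun do rewrite mul1r.
Qed.

Definition edge_midpoint {R : realType} (k i : nat) : simplex R :=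
  exist (fun x => x \in simplex R) _ (mem_set (simplex_midpoint k i)).

(** The row limit is [(a k k + a k i) / 2], and skew symmetry kills [a k k]. The value is affine and
    injective in [a k i]. *)
Lemma volterra_midpoint {R : realType} (a : nat -> nat -> R)
    (V : simplex R -> simplex R) (k i : nat) :
  volterra_with a V -> k <> i ->
  to_seq_map V (edge_midpoint k i) k =
  2^-1 * (1 + a k i / 2).
Proof.
move=> [ska aV] /eqP/negbTE ki; rewrite /to_seq_map aV /=.
have /cvg_lim -> // := cvg_series_midpoint (a k) k i.
by rewrite (skew_matrix_diag k ska) add0r /midpoint eqxx ki mulr0 addr0 mulr1.
Qed.

(** Adds [s] times the elementary skew-symmetric matrix [E_ki - E_ik]. *)
Definition perturb {R : realType} (a : nat -> nat -> R) (k i : nat) (s : R) :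
    nat -> nat -> R :=
  fun n j => a n j + s * ((n == k)%:R * (j == i)%:R - (n == i)%:R * (j == k)%:R).

Lemma skew_perturb {R : realType} (a : nat -> nat -> R) (k i : nat) (s : R) :
  k <> i -> `|s| <= 1 - `|a k i| -> skew_matrix a ->
  skew_matrix (perturb a k i s).
Proof.
move=> /eqP ki sa ska n j; split; rewrite /perturb.
  by rewrite (ska n j).1; ring.
have [nk|nk] := eqVneq n k; have [ji|ji] := eqVneq j i.
- subst n j; rewrite (negbTE ki) !mul0r subr0 !mulr1.
  by apply: le_trans (ler_normD _ _) _; lra.
- subst n; rewrite (negbTE ki) mul0r mulr0 subr0 mulr0 addr0.
  exact: (ska _ _).2.
- subst j; rewrite (eq_sym i k) (negbTE ki) mul0r mulr0 subr0 mulr0 addr0.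
  exact: (ska _ _).2.
- rewrite mul0r sub0r.
  have [ni|ni] := eqVneq n i; last first.
    by rewrite mul0r oppr0 mulr0 addr0; exact: (ska _ _).2.
  have [jk|jk] := eqVneq j k; last first.
    by rewrite mulr0 oppr0 mulr0 addr0; exact: (ska _ _).2.
  (* By skew symmetry this entry is [- (a k i + s)], so the bound at [(k, i)] applies again. *)
  subst n j; rewrite (ska i k).1 mulr1 mulrN1 -opprD normrN.
  by apply: le_trans (ler_normD _ _) _; lra.
Qed.

Lemma lim_row_perturb {R : realType} (a : nat -> nat -> R) (k i : nat) (s : R)
    (x : nat -> R^o) (n : nat) :
  skew_matrix a -> simplex R x ->
  limn (series (fun j => perturb a k i s n j * x j : R)) =
  limn (series (fun j => a n j * x j : R)) +
  s * ((n == k)%:R * x i - (n == i)%:R * x k).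
Proof.
move=> ska Sx; apply/cvg_lim => //.
have -> : (fun j => perturb a k i s n j * x j) =
    (fun j => a n j * x j) +
    ((fun j => s * (n == k)%:R * x j * (j == i)%:R) +
     (fun j => - s * (n == i)%:R * x j * (j == k)%:R)).
  by apply/funext => j; rewrite /perturb !fctE; ring.
have -> : s * ((n == k)%:R * x i - (n == i)%:R * x k) =
    s * (n == k)%:R * x i + (- s * (n == i)%:R * x k) by ring.
rewrite !seriesD; apply: cvgD; first exact: is_cvg_row.
apply: cvgD.
- exact: (cvg_series_delta (fun j => s * (n == k)%:R * x j)).
- exact: (cvg_series_delta (fun j => - s * (n == i)%:R * x j)).
Qed.

(* The perturbation only moves the mass [s * x k * x i] from coordinate [i] to
   coordinate [k], so the total mass needs no rearrangement of double series. *)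
Lemma volterra_perturb {R : realType} (a : nat -> nat -> R)
    (V : simplex R -> simplex R) (k i : nat) (s : R) :
  volterra_with a V -> k <> i -> `|s| <= 1 - `|a k i| ->
  exists W, volterra_with (perturb a k i s) W.
Proof.
move=> [ska aV] ki sa; have skb := skew_perturb a k i s ki sa ska.
pose b := perturb a k i s.
pose w (x : simplex R) : nat -> R^o :=
  fun n => val x n * (1 + limn (series (fun j => b n j * val x j) : R^nat)).
have Sw x : simplex R (w x).
  have Sx : simplex R (val x) by exact: set_mem (valP x).
  have [x0 _] := (simplexP _).1 Sx.
  have [_ Vx1] := (simplexP _).1 (set_mem (valP (V x))).
  apply/simplexP; split=> [n|].
    (* The perturbed matrix is still skew with entries bounded by 1, so its row limit is at least
       -1. *)
    rewrite mulr_ge0//.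
    by have := norm_lim_row_le1 skb Sx n; rewrite ler_norml; lra.
  pose c : R := s * val x k * val x i.
  have -> : (w x : R ^nat) = (val (V x) : R ^nat) +
      ((fun n => c * (n == k)%:R) + (fun n => - c * (n == i)%:R)).
    apply/funext => n; rewrite /w /b lim_row_perturb// !fctE aV /c.
    by case: (eqVneq n k) => [->|_]; case: (eqVneq _ i) => [->|_] /=; ring.
  have -> : nbhs (1 : R) = nbhs (1 + (c - c)) by rewrite subrr addr0.
  rewrite !seriesD; apply: cvgD => //; apply: cvgD.
  - exact: (cvg_series_delta (fun=> c)).
  - exact: (cvg_series_delta (fun=> - c)).
by exists (fun x => exist (fun y => y \in simplex R) _ (mem_set (Sw x))); split.
Qed.

(** At an endpoint of [[-1, 1]], the distances of [b] and [c] to [a] are nonnegative with a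
    positively weighted sum equal to zero, so both vanish. *)
Lemma unimodular_convex_comb {R : realFieldType} (a b c t : R) :
  `|a| = 1 -> `|b| <= 1 -> `|c| <= 1 -> 0 < t < 1 ->
  a = t * b + (1 - t) * c -> b = a /\ c = a.
Proof.
move=> a1; rewrite !ler_norml => /andP[b1 b2] /andP[c1 c2] /andP[t0 t1] abc.
have [a0|a0] := lerP 0 a; [rewrite ger0_norm// in a1|rewrite ltr0_norm// in a1].
- by split; apply/eqP; rewrite eq_le; apply/andP; split; nra.
- by split; apply/eqP; rewrite eq_le; apply/andP; split; nra.
Qed.

(** Leads back from entries to operators; both diagonals are zero by skew symmetry. *)
Lemma volterra_with_inj {R : realType} (a b : nat -> nat -> R)
    (V W : simplex R -> simplex R) :
  volterra_with a V -> volterra_with b W ->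
  (forall k i, k <> i -> b k i = a k i) -> to_seq_map W = to_seq_map V.
Proof.
move=> [ska aV] [skb bW] ba; apply/funext => x; apply/funext => k.
rewrite /to_seq_map aV bW.
suff -> : (fun i => b k i * val x i) = (fun i => a k i * val x i) by [].
apply/funext => i; have [->|/eqP ki] := eqVneq k i.
  by rewrite !skew_matrix_diag.
by rewrite ba.
Qed.

Theorem corollary4p4 (R : realType) (a : nat -> nat -> R)
    (V : simplex R -> simplex R) (hV : volterra_with a V) :
  extreme_point (@to_seq_map R @` volterra R) (to_seq_map V) <->
  (forall k i : nat, k <> i -> `|a k i| = 1).
Proof.
have [ska aV] := hV; split=> [[_ extV] k i ki|a1]; last first.
  split; first by exists V => //; exists a.
  move=> _ _ t [X [b hX] <-] [Y [c hY] <-] t01 VE.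
  have bca k i : k <> i -> b k i = a k i /\ c k i = a k i.
    move=> ki; apply: (unimodular_convex_comb _ _ _ t) => //.
    - exact: a1.
    - exact: (hX.1 k i).2.
    - exact: (hY.1 k i).2.
    (* Coordinate [k] at the midpoint is affine in the entry; since the weights sum to 1, the
       constants cancel and the entries satisfy the same combination. *)
    - pose m : simplex R := edge_midpoint k i.
      have : to_seq_map V m k =
          t * to_seq_map X m k + (1 - t) * to_seq_map Y m k by rewrite VE.
      rewrite (volterra_midpoint _ _ _ _ hV ki).
      rewrite (volterra_midpoint _ _ _ _ hX ki).
      by rewrite (volterra_midpoint _ _ _ _ hY ki); lra.
  split; apply: volterra_with_inj hV _ _; try eassumption.
  - by move=> k i /bca[].
  - by move=> k i /bca[].
apply/eqP; rewrite eq_le (ska k i).2 leNgt; apply/negP => a1.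
(* The largest shift for which both [a k i + s] and [a k i - s] stay in [[-1, 1]]. *)
pose s := 1 - `|a k i|.
have s0 : 0 < s by rewrite /s; lra.
have [X hX] : exists X, volterra_with (perturb a k i s) X.
  by apply: volterra_perturb hV ki _; rewrite gtr0_norm.
have [Y hY] : exists Y, volterra_with (perturb a k i (- s)) Y.
  by apply: volterra_perturb hV ki _; rewrite normrN gtr0_norm.
have [] : to_seq_map X = to_seq_map V /\ to_seq_map Y = to_seq_map V.
  apply: (extV _ _ 2^-1).
  - by exists X => //; eexists; exact: hX.
  - by exists Y => //; eexists; exact: hY.
  - by lra.
  - apply/funext => x; apply/funext => n.
    have Sx : simplex R (val x) by exact: set_mem (valP x).
    (* Row limits are affine in the shift, so the terms in [s] and [- s] cancel in the average. *)
    rewrite !fctE /to_seq_map hX.2 hY.2 aV !lim_row_perturb//.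
    rewrite /GRing.scale/=; lra.
move=> XV _.
(* Reading the entry [(k, i)] off [X] and off [V] gives [a k i + s = a k i], against [0 < s]. *)
have := volterra_midpoint _ _ _ _ hX ki.
rewrite XV (volterra_midpoint _ _ _ _ hV ki) /perturb !eqxx.
have /eqP/negbTE -> := ki.
by rewrite mul0r subr0 !mulr1; lra.
Qed.
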